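(* Let $V$ be an Archimedean ordered vector space and let $T : V \to V$ be a positive linear map. Let $v \in V$ with $v \ge 0$. If $(T-\operatorname{id})^{r+1} v \le 0$ for an integer $r \ge 0$, then $(T-\operatorname{id})^r v \ge 0$.
   Context: An ordered vector space is a real vector space $V$ (not assumed finite-dimensional) together with a subset $V_+ \subseteq V$, the positive cone, such that $\alpha V_+ + \beta V_+ \subseteq V_+$ for all scalars $\alpha,\beta \in [0,\infty)$ and $V_+ \cap (-V_+) = \{0\}$. The partial order on $V$ is given by $v \le w$ if and only if $w - v \in V_+$. The space $V$ is Archimedean if for all $v,w \in V$: whenever $v \le \frac{1}{n} w$ for all integers $n \ge 1$, then $v \le 0$. A linear map $T : V \to V$ is positive if $T V_+ \subseteq V_+$. The identity map on $V$ is denoted by $\operatorname{id}$. *)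

(* Defs.v *)
From mathcomp Require Import all_boot all_order all_algebra.
From mathcomp Require Import classical_sets reals.

Set Implicit Arguments.
Unset Strict Implicit.
Unset Printing Implicit Defensive.

Import Order.TTheory GRing.Theory Num.Theory.

Local Open Scope classical_set_scope.
Local Open Scope ring_scope.

Definition positive_cone (R : realType) (V : lmodType R) (C : set V) : Prop :=
  (forall a b : R, 0 <= a -> 0 <= b ->
     [set a *: x + b *: y | x in C & y in C] `<=` C) /\
  C `&` [set - x | x in C] = [set 0].

Definition cone_le (R : realType) (V : lmodType R) (C : set V) (v w : V) :
  Prop := C (w - v).

Definition archimedean_cone (R : realType) (V : lmodType R) (C : set V) :
  Prop :=
  forall v w : V,
    (forall n : nat, (1 <= n)%N -> cone_le C v (n%:R^-1 *: w)) ->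
    cone_le C v 0.

Definition positive_map (R : realType) (V : lmodType R) (C : set V)
  (T : V -> V) : Prop := T @` C `<=` C.

(* Main.v *)
Require Import Defs.
From mathcomp Require Import all_boot all_order all_algebra.
From mathcomp Require Import classical_sets reals.

Import Order.TTheory GRing.Theory Num.Theory.

Local Open Scope ring_scope.

(** Write [S = T - id] and [w_k = S^k v].  The binomial formula gives
    [T^n v = \sum_k C(n, k) w_k], and the truncations
    [P_n = \sum_(k <= r) C(n, k) w_k] satisfy
    [T P_n = P_(n+1) + C(n, r) w_(r+1)] by Pascal's rule
    ([binomial_truncation_step]).  As [P_0 = v >= 0] and [w_(r+1) <= 0], every
    [P_n] is positive ([binomial_truncation_ge0]).  In [P_n], a polynomial
    in [n] with coefficients in [V], the term [C(n, r) w_r] dominates: dividing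
    by [C(n, r)] and letting [n] grow should leave [w_r >= 0].

    The Archimedean property only allows this passage to the limit if the lower
    terms are controlled in the order of [V], where an arbitrary vector need not
    lie below a positive one.  The vectors [w_k] do, being differences of
    positive vectors: [- u_k <= w_k <= u_k] with [u_k = (T + id)^k v]
    ([iter_sub_id_dominated]).  Choosing [m] with [n C(m, k) <= C(m, r)] for all
    [k < r] ([bin_dominates_lower]) gives [- w_r <= n^-1 \sum_(k < r) u_k],
    whence [- w_r <= 0]. *)

Lemma bin_mul_leq (n m k : nat) :
  (n * k.+1 + k <= m)%N -> (n * 'C(m, k) <= 'C(m, k.+1))%N.
Proof.
move=> hm; rewrite -(leq_pmul2l (ltn0Sn k)) mulnA mul_bin_left.
have km : (k <= m)%N := leq_trans (leq_addl _ _) hm.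
by rewrite leq_mul2r mulnC leq_subRL // addnC hm orbT.
Qed.

(** Consecutive binomials satisfy [C(m, k+1) / C(m, k) = (m - k) / (k + 1)], and
    this ratio is at least [n] for [k < r] as soon as [m >= n r + r]. *)
Lemma bin_dominates_lower (n r k : nat) :
  (0 < n)%N -> (k < r)%N -> (n * 'C(n * r + r, k) <= 'C(n * r + r, r))%N.
Proof.
move=> n_gt0; set m := (n * r + r)%N.
have step j : (j < r)%N -> (n * 'C(m, j) <= 'C(m, j.+1))%N.
  by move=> jr; apply: bin_mul_leq; rewrite leq_add ?leq_mul // ltnW.
suff: forall d, (k + d.+1 <= r)%N -> (n * 'C(m, k) <= 'C(m, k + d.+1))%N.
  by move=> + kr => /(_ (r - k.+1)%N); rewrite addnS -addSn subnKC //; apply.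
elim=> [|d IHd] hd; first by rewrite addn1 step // -addn1.
rewrite addnS in hd *; apply: leq_trans (IHd (ltnW hd)) _.
by apply: leq_trans (step _ hd); rewrite leq_pmull.
Qed.

Section Cone.

Context {R : realType} {V : lmodType R} {C : set V}.
Hypothesis coneC : positive_cone C.

Lemma cone0 : C 0.
Proof.
have [_ pointed] := coneC.
by have [] : (C `&` [set - x | x in C])%classic 0 by rewrite pointed.
Qed.

Lemma coneD (x y : V) : C x -> C y -> C (x + y).
Proof.
move=> Cx Cy; have [closed _] := coneC.
by apply: (closed 1 1) => //; exists x => //; exists y => //; rewrite !scale1r.
Qed.

Lemma coneZ (a : R) (x : V) : 0 <= a -> C x -> C (a *: x).
Proof.
move=> a_ge0 Cx; have [closed _] := coneC; apply: (closed a 0) => //.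
by exists x => //; exists x => //; rewrite scale0r addr0.
Qed.

Lemma coneMn (n : nat) (x : V) : C x -> C (x *+ n).
Proof. by move=> Cx; rewrite -scaler_nat; apply: coneZ. Qed.

Lemma cone_sum (I : Type) (s : seq I) (P : pred I) (F : I -> V) :
  (forall i, P i -> C (F i)) -> C (\sum_(i <- s | P i) F i).
Proof. by move=> CF; apply: big_ind => //; [exact: cone0 | exact: coneD]. Qed.

Section PositiveMap.

Context {T : {linear V -> V}}.
Hypothesis posT : positive_map C T.

Lemma positive_map_cone (x : V) : C x -> C (T x).
Proof. by move=> Cx; apply: posT; exists x. Qed.

Lemma iter_add_id_cone (k : nat) (v : V) : C v -> C (iter k (T \+ idfun) v).
Proof.
move=> Cv; elim: k => //= k IHk.
by apply: coneD => //; exact: positive_map_cone.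
Qed.

(** Both bounds are needed together: with [w] and [u] the two iterates,
    [(T + id) u - (T - id) w = T (u - w) + (u + w)], so the minus sign in
    [T - id] swaps them. *)
Lemma iter_sub_id_dominated (k : nat) (v : V) : C v ->
  C (iter k (T \+ idfun) v - iter k (T \- idfun) v) /\
  C (iter k (T \+ idfun) v + iter k (T \- idfun) v).
Proof.
move=> Cv; elim: k => [|k [IHB IHD]] /=.
  by rewrite subrr; split; [exact: cone0 | exact: coneD].
set u := iter k _ v in IHB IHD *; set w := iter k _ v in IHB IHD *.
split.
  have -> : T u + u - (T w - w) = T (u - w) + (u + w).
    by rewrite opprB [w - _]addrC addrACA linearB.
  by apply: coneD => //; exact: positive_map_cone.
by rewrite addrACA -linearD; apply: coneD => //; exact: positive_map_cone.
Qed.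

(** The full sum would satisfy [T P_n = P_(n+1)]; shifting the index in
    [\sum_k C(n, k) w_(k+1)] and applying Pascal's rule leaves only the boundary
    term at [k = r]. *)
Lemma binomial_truncation_step (w : nat -> V) (n r : nat) :
  (forall k, T (w k) = w k + w k.+1) ->
  T (\sum_(k < r.+1) w k *+ 'C(n, k)) =
  \sum_(k < r.+1) w k *+ 'C(n.+1, k) + w r.+1 *+ 'C(n, r).
Proof.
move=> Tw; elim: r => [|r IHr].
  by rewrite !big_ord_recr !big_ord0 /= !add0r !bin0 Tw.
rewrite big_ord_recr linearD IHr [in RHS]big_ord_recr /= raddfMn.
rewrite [X in _ + X *+ _ = _]Tw binS mulrnDr mulrnDl -!addrA.
by rewrite [X in _ + X = _]addrCA.
Qed.

Lemma binomial_truncation_ge0 (n r : nat) (v : V) :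
  C v -> C (- iter r.+1 (T \- idfun) v) ->
  C (\sum_(k < r.+1) iter k (T \- idfun) v *+ 'C(n, k)).
Proof.
move=> Cv Cw; elim: n => [|n IHn].
  by rewrite big_ord_recl big1 ?addr0 // => i _; rewrite mulr0n.
have /esym/(canRL (addrK _)) -> := binomial_truncation_step
  (fun k => iter k (T \- idfun) v) n r (fun k => esym (subrKC _ _)).
by rewrite -mulNrn; apply: coneD; [exact: positive_map_cone | exact: coneMn].
Qed.

End PositiveMap.
End Cone.

Theorem theorem3p4 (R : realType) (V : lmodType R) (Vpos : set V)
    (hcone : positive_cone Vpos) (harch : archimedean_cone Vpos)
    (T : {linear V -> V}) (hT : positive_map Vpos T)
    (v : V) (hv : cone_le Vpos 0 v) (r : nat)
    (hr : cone_le Vpos (iter r.+1 (T \- idfun) v) 0) :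
  cone_le Vpos 0 (iter r (T \- idfun) v).
Proof.
rewrite /cone_le subr0 in hv; rewrite /cone_le sub0r in hr.
set w := fun k => iter k (T \- idfun) v; pose u k := iter k (T \+ idfun) v.
rewrite /cone_le subr0 -[iter _ _ _]opprK -sub0r.
apply: (harch _ (\sum_(k < r) u k)).
move=> n n_gt0; rewrite /cone_le opprK -/(w r).
set m := (n * r + r)%N; set b := 'C(m, r).
have b_gt0 : (0 < b)%N by rewrite bin_gt0 leq_addl.
(* Multiplied by [n b], the vector becomes [n P_m] plus the slack
   [\sum_(k < r) (b u_k - n C(m, k) w_k)], which splits into positive parts
   because [n C(m, k) <= b]. *)
suff Cnb : Vpos ((n * b)%:R *: (n%:R^-1 *: (\sum_(k < r) u k) + w r)).
  have nb_neq0 : (n * b)%:R != 0 :> R by rewrite pnatr_eq0 -lt0n muln_gt0 n_gt0.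
  have nbV_ge0 : 0 <= (n * b)%:R^-1 :> R by rewrite invr_ge0.
  by have := coneZ hcone _ _ nbV_ge0 Cnb; rewrite scalerA mulVf // scale1r.
have -> : (n * b)%:R *: (n%:R^-1 *: (\sum_(k < r) u k) + w r) =
    (\sum_(k < r.+1) w k *+ 'C(m, k)) *+ n +
    (\sum_(k < r) (u k *+ (b - n * 'C(m, k)) + (u k - w k) *+ (n * 'C(m, k)))).
  rewrite scalerDr scalerA natrM mulrAC mulfV ?pnatr_eq0 -?lt0n // mul1r.
  rewrite -natrM !scaler_nat big_ord_recr /= mulrnDl -mulrnA.
  rewrite [(b * n)%N]mulnC addrAC; congr (_ + _).
  rewrite -!sumrMnl -big_split /=; apply: eq_bigr => k _.
  rewrite -mulrnA [('C(m, k) * n)%N]mulnC mulrnBl addrCA.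
  rewrite [w k *+ _ + _]addrC subrK.
  by rewrite -mulrnDr subnK // bin_dominates_lower.
apply: coneD => //.
  by apply: coneMn => //; exact: binomial_truncation_ge0.
apply: cone_sum => // k _; apply: coneD => //; apply: coneMn => //.
  exact: iter_add_id_cone.
by have [] := iter_sub_id_dominated hcone hT k _ hv.
Qed.
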